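(* Let $n \ge 1$ be an integer and let $p \ge 1$ be real. For any nonsequential Monte Carlo method with sample size $n$, with estimator $\hat{S}_n$, $$e_p(\hat{S}_n) \;\geq\; \left(\frac{1}{2}\right)^{2+1/p}\, \frac{1}{n}.$$
   Context: Let $F$ be the class of all non-decreasing functions $f : [0,1] \to [0,1]$, and for $f \in F$ let $S(f) = \int_0^1 f(x)\,\mathrm{d}x$. A nonsequential Monte Carlo method with sample size $n$ is given by a random vector $(X_1, \ldots, X_n)$ of evaluation points in $[0,1]$ with an arbitrary joint distribution (not depending on $f$) and a (deterministic) measurable function $\varphi : [0,1]^{2n} \to \mathbb{R}$; it approximates $S(f)$ by the estimator $\hat{S}_n(f) = \varphi(X_1, f(X_1), \ldots, X_n, f(X_n))$. Its worst-case $L^p$ error over $F$ is $$e_p(\hat{S}_n) = \sup_{f \in F} \mathbb{E}\left( \left| S(f) - \hat{S}_n(f) \right|^p \right)^{1/p},$$ which may be $+\infty$. *)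

(* Defs.v *)
From HB Require Import structures.
From mathcomp Require Import all_boot all_order all_algebra.
From mathcomp Require Import all_classical all_reals all_analysis.

Set Implicit Arguments.
Unset Strict Implicit.
Unset Printing Implicit Defensive.

Import Order.TTheory GRing.Theory Num.Theory.
Import numFieldNormedType.Exports.

Local Open Scope classical_set_scope.
Local Open Scope ring_scope.

(* A function [0, 1] -> [0, 1] is encoded as a total function on R of which
   only the restriction to [0, 1] is constrained (and ever used). *)
Definition monotone_class (R : realType) : set (R -> R) :=
  [set f : R -> R |
    {in `[0, 1] &, {homo f : x y / x <= y}} /\
    (forall x : R, x \in `[0, 1] -> f x \in `[0, 1])].

Definition integral01 (R : realType) (f : R -> R) : R :=
  \int[lebesgue_measure]_(x in `[0, 1]) f x.

(* The cube [0, 1]^n. *)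
Definition cube01 (R : realType) (n : nat) : set (n.-tuple R) :=
  [set x | forall i : 'I_n, tnth x i \in `[0, 1]].

(* The cube [0, 1]^(2n), its points (x_1, y_1, ..., x_n, y_n) being grouped as
   n pairs (x_i, y_i). *)
Definition pair_cube01 (R : realType) (n : nat) : set (n.-tuple (R * R)) :=
  [set t | forall i : 'I_n,
    (tnth t i).1 \in `[0, 1] /\ (tnth t i).2 \in `[0, 1]].

Definition samples (R : realType) (n : nat) (f : R -> R) (x : n.-tuple R) :
    n.-tuple (R * R) :=
  [tuple (tnth x i, f (tnth x i)) | i < n].

Definition estimator (R : realType) (Omega : Type) (n : nat)
    (X : Omega -> n.-tuple R) (phi : n.-tuple (R * R) -> R) (f : R -> R) :
    Omega -> R :=
  fun w => phi (samples f (X w)).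

Definition worst_case_error d (Omega : measurableType d) (R : realType)
    (P : probability Omega R) (p : R) (Shat : (R -> R) -> Omega -> R) :
    \bar R :=
  ereal_sup [set poweR 'E_P[fun w => `|integral01 f - Shat f w| `^ p] p^-1
            | f in @monotone_class R].

(* Main.v *)
Require Import Defs.
From HB Require Import structures.
From mathcomp Require Import all_boot all_order all_algebra.
From mathcomp Require Import all_classical all_reals all_analysis.
From mathcomp Require Import measurable_realfun ring lra.

Import Order.TTheory GRing.Theory Num.Theory.
Import numFieldNormedType.Exports.

Local Open Scope classical_set_scope.
Local Open Scope ring_scope.

(** Two monotone functions that no sample distinguishes force an error on one of
    them. Cut [0, 1[ into m = 2n cells of length 1/(2n). For each of the n
    sample points the cells are disjoint events, so the expected number of cells
    that contain a sample is at most n; hence some cell [a, b[ contains no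
    sample with probability at least 1/2 ([rarely_hit_cell]).
    The indicators of [a, +oo[ and [b, +oo[ are monotone and differ only on
    that cell. On the event that the cell is missed they produce the same
    samples ([samples_step_eq]), hence the same estimate s, although their
    integrals differ by b - a = 2h, with h = 1/(4n). For p >= 1, convexity
    gives |S(f) - s|^p + |S(g) - s|^p >= 2h^p whatever s is ([two_point_powR]);
    integrating over the event ([two_point_expectation]), the p-th moments of
    the two errors sum to at least h^p, so one of them is at least h^p / 2. Its
    p-th root is (1/2)^(1/p) / (4n), which is the claimed bound.

    The cell is chosen from the joint law of the sample points alone: this is
    where it matters that the points do not depend on f. *)

Set Implicit Arguments.
Unset Strict Implicit.
Unset Printing Implicit Defensive.

Definition step (R : realType) (a x : R) : R := (a <= x)%R%:R.

Lemma stepE (R : realType) (a : R) : step a = \1_(`[a, +oo[).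
Proof. by apply/funext => x; rewrite indicE mem_setE in_itv /= andbT. Qed.

Lemma measurable_step (R : realType) (a : R) : measurable_fun setT (step a).
Proof. by rewrite stepE; exact: measurable_indic. Qed.

Lemma step_monotone (R : realType) (a : R) : @monotone_class R (step a).
Proof.
split=> [x y _ _ xy|x _]; rewrite /step.
  by rewrite ler_nat; case: (leP a x) => // /le_trans ->.
by rewrite in_itv /=; case: (a <= x); rewrite ?lexx ler01.
Qed.

Lemma integral01_step (R : realType) (a : R) :
  a \in `[0, 1] -> integral01 (step a) = 1 - a.
Proof.
rewrite in_itv /= => /andP[a0 a1].
rewrite /integral01 /Rintegral stepE integral_indic //=.
have -> : `[a, +oo[ `&` `[0, 1] = (`[a, 1]%classic : set R).
  apply/seteqP; split=> x /=; rewrite !in_itv /= andbT.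
    by move=> [-> /andP[_ ->]].
  by move=> /andP[ax ->]; rewrite ax (le_trans a0 ax).
rewrite lebesgue_measure_itv /= lte_fin -EFinB.
by case: ltP => //= a1'; rewrite (@le_anti _ _ a 1) ?a1 ?a1' // subrr.
Qed.

Lemma samples_step_eq (R : realType) (n : nat) (a b : R) (x : n.-tuple R) :
  a <= b -> (forall j, tnth x j \notin `[a, b[) ->
  samples (step a) x = samples (step b) x.
Proof.
move=> ab xab; apply: eq_from_tnth => j; rewrite !tnth_mktuple; congr pair.
rewrite /step; move: (xab j); rewrite in_itv /= negb_and -ltNge -leNgt.
have [bx _|_] := leP b (tnth x j); first by rewrite (le_trans ab bx).
by rewrite orbF ltNge => /negPf ->.
Qed.

(** Convexity of the p-th power; this is where p >= 1 enters. *)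
Lemma powR_midpoint (R : realType) (p x y : R) : 1 <= p -> 0 <= x -> 0 <= y ->
  2 * ((x + y) / 2) `^ p <= x `^ p + y `^ p.
Proof.
move=> p1 x0 y0.
have h01 : 0 <= (2^-1 : R) <= 1 by lra.
have := convex_powR p1 (Itv01 (proj1 (andP h01)) (proj2 (andP h01)))
  (x := x) (y := y).
rewrite !inE /= !in_itv /= !andbT => /(_ x0 y0).
rewrite /conv /= /conv /= /unstable.onem.
rewrite (_ : 2^-1 *: x + (1 - 2^-1) *: y = (x + y) / 2 :> R).
  by rewrite /GRing.scale /=; lra.
by rewrite /GRing.scale /=; field.
Qed.

(** No single estimate s is good for two targets at distance 2h: the distances
    from s to a and to b average at least h, and the p-th power is convex. *)
Lemma two_point_powR (R : realType) (p a b h s : R) : 1 <= p -> 0 <= h ->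
  2 * h <= `|a - b| -> 2 * h `^ p <= `|a - s| `^ p + `|b - s| `^ p.
Proof.
move=> p1 h0 hab.
apply: le_trans (powR_midpoint p1 (normr_ge0 _) (normr_ge0 _)).
rewrite ler_pM2l //; apply: ge0_ler_powR; rewrite ?nnegrE //.
- exact: le_trans p1.
- rewrite ler_pdivlMr // mulrC (le_trans hab) //.
  by rewrite (distrC b s) ler_distD.
Qed.

(** Two-point method: S and T stand for the estimates of the targets a and b.
    Only the event A where they coincide is used; outside A the errors are
    bounded below by 0. *)
Lemma two_point_expectation d (Omega : measurableType d) (R : realType)
    (P : probability Omega R) (p a b h : R) (S T : Omega -> R)
    (A : set Omega) :
  1 <= p -> 0 <= h -> 2 * h <= `|a - b| ->
  measurable_fun setT S -> measurable_fun setT T -> measurable A ->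
  {in A, S =1 T} ->
  ((2 * h `^ p)%:E * P A <=
     'E_P[fun w => (`|a - S w| `^ p)%R] +
     'E_P[fun w => (`|b - T w| `^ p)%R])%E.
Proof.
move=> p1 h0 hab mS mT mA ST.
have mE (c : R) (U : Omega -> R) : measurable_fun setT U ->
    measurable_fun setT (fun w : Omega => (`|c - U w| `^ p)%R%:E).
  move=> mU; apply/measurable_EFinP.
  apply: (measurableT_comp (measurable_powR p)).
  apply: measurableT_comp => //.
  by apply: measurable_funB.
have ge0 (c : R) (U : Omega -> R) (w : Omega) : (0 <= (`|c - U w| `^ p)%R%:E)%E.
  by rewrite lee_fin powR_ge0.
rewrite unlock -ge0_integralD //; [|exact: mE|exact: mE].
rewrite -integral_cst //.
apply: (@le_trans _ _
  (\int[P]_(w in A) ((`|a - S w| `^ p)%R%:E + (`|b - T w| `^ p)%R%:E))%E).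
  apply: ge0_le_integral => //=.
  - by move=> w _; rewrite lee_fin mulr_ge0 // powR_ge0.
  - by apply/(measurable_funS _ (@subsetT _ A)) => //;
      apply: emeasurable_funD; exact: mE.
  - move=> w Aw; rewrite -EFinD lee_fin ST ?inE //; exact: two_point_powR.
apply: ge0_subset_integral => //=.
- by apply: emeasurable_funD; exact: mE.
- by move=> w _; rewrite adde_ge0.
Qed.

(** A random set of n points meets on average at most n of m disjoint cells, so
    some cell is met with probability at most n / m. The n points may be
    dependent: the events that each of them meets a given cell are combined by
    a union bound, while for a given point the cells are disjoint events. *)
Lemma rarely_hit_cell d (Omega : measurableType d) (R : realType)
    (P : probability Omega R) d' (T : measurableType d') (n m : nat)
    (X : Omega -> n.-tuple T) (I : 'I_m -> set T) :
  (0 < m)%N -> measurable_fun setT X -> (forall i, measurable (I i)) ->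
  trivIset setT I ->
  exists i, let H := [set w | exists j, I i (tnth (X w) j)] in
    measurable H /\ (P H <= (n%:R / m%:R)%:E)%E.
Proof.
move=> m0 mX mI tI.
pose F i j := [set w | I i (tnth (X w) j)].
pose H i := [set w | exists j, I i (tnth (X w) j)].
have mF i j : measurable (F i j).
  have mXj := measurableT_comp (measurable_tnth j) mX.
  by rewrite -[F i j]setTI; exact: mXj.
have HE i : H i = \big[setU/set0]_(j < n) F i j.
  rewrite -bigcup_seq; apply/seteqP; split=> w [j].
    by exists j; rewrite //= mem_index_enum.
  by move=> _ ?; exists j.
have mH i : measurable (H i) by rewrite HE; apply: bigsetU_measurable.
have hitP i : (P (H i) <= \sum_(j < n) P (F i j))%E.
  rewrite HE.
  suff [] : measurable (\big[setU/set0]_(j < n) F i j) /\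
    (P (\big[setU/set0]_(j < n) F i j) <= \sum_(j < n) P (F i j))%E by [].
  elim/big_rec2: _ => [|j s A _ [mA As]]; first by rewrite measure0.
  split; first exact: measurableU.
  by apply: (le_trans (measureU2 _ _ _)) => //; rewrite leeD2l.
have cellP j : (\sum_(i < m) P (F i j) <= 1)%E.
  rewrite -measure_bigsetU_ord //; last first.
    by move=> i i' _ _ [w [Fi Fi']]; apply: tI => //; exists (tnth (X w) j).
  by apply: probability_le1; exact: bigsetU_measurable.
(* Exchange the two sums: sum over the cells first, for each point. *)
have tot : (\sum_(i < m) P (H i) <= n%:R%:E)%E.
  apply: (@le_trans _ _ (\sum_(i < m) \sum_(j < n) P (F i j))%E).
    exact: lee_sum.
  rewrite exchange_big /= (le_trans (lee_sum _ (fun j _ => cellP j))) //.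
  by rewrite sumEFin sumr_const card_ord.
apply: contrapT => /forallNP none.
have big i : (n%:R / m%:R < fine (P (H i))).
  rewrite -lte_fin fineK ?fin_num_measure // ltNge; apply/negP => le.
  by apply: (none i); split=> //; exact: mH.
have tot' : \sum_(i < m) fine (P (H i)) <= n%:R.
  rewrite -lee_fin -sumEFin (le_trans _ tot) // le_eqVlt; apply/predU1P; left.
  by apply: eq_bigr => i _; rewrite fineK ?fin_num_measure.
suff : n%:R < \sum_(i < m) fine (P (H i)) by rewrite ltNge tot'.
apply: (@le_lt_trans _ _ (\sum_(i < m) (n%:R / m%:R : R))).
  by rewrite sumr_const card_ord -[_ *+ m]mulr_natr divfK // pnatr_eq0 -lt0n.
by apply: ltr_sum => //; apply/hasP; exists (Ordinal m0).
Qed.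

(** Since phi is measurable only on the cube, the samples must be known to stay
    in it, and the cube itself must be measurable. *)
Lemma measurable_estimator d (Omega : measurableType d) (R : realType)
    (n : nat) (X : Omega -> n.-tuple R) (phi : n.-tuple (R * R) -> R)
    (f : R -> R) :
  measurable_fun setT X -> (forall w, cube01 (X w)) ->
  measurable_fun (@pair_cube01 R n) phi ->
  measurable_fun setT f -> (forall x, x \in `[0, 1] -> f x \in `[0, 1]) ->
  measurable_fun setT (estimator X phi f).
Proof.
move=> mX hX mphi mf f01.
apply: (@measurable_comp _ _ _ _ _ _ (@pair_cube01 R n) phi setT
          (fun w => samples f (X w))) => //.
- have -> : @pair_cube01 R n = \bigcap_(i in [set: 'I_n])
      ((fun t : n.-tuple (R * R) => tnth t i) @^-1` (`[0, 1] `*` `[0, 1])).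
    apply/seteqP; split=> t /= ht i; first by move=> _; exact: ht.
    exact: (ht i I).
  apply: fin_bigcap_measurable => // i _.
  rewrite -[_ @^-1` _]setTI; apply: measurable_tnth => //.
  exact: measurableX.
- by move=> _ [w _ <-] i; rewrite tnth_mktuple /=; split; [|apply: f01];
    exact: hX.
- apply/measurable_fun_tnthP => i.
  rewrite (_ : _ \o _ = fun w => (tnth (X w) i, f (tnth (X w) i))); last first.
    by apply/funext => w /=; rewrite tnth_mktuple.
  have mXi : measurable_fun setT (fun w => tnth (X w) i).
    exact: (measurableT_comp (measurable_tnth i) mX).
  by apply: measurable_fun_pair => //; exact: measurableT_comp.
Qed.

Lemma le_worst_case_error d (Omega : measurableType d) (R : realType)
    (P : probability Omega R) (p c : R) (Shat : (R -> R) -> Omega -> R)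
    (f : R -> R) :
  0 <= p -> 0 <= c -> @monotone_class R f ->
  (c%:E <= 'E_P[fun w => (`|integral01 f - Shat f w| `^ p)%R])%E ->
  ((c `^ p^-1)%:E <= worst_case_error P p Shat)%E.
Proof.
move=> p0 c0 mf cE.
apply: le_trans; last by apply: ereal_sup_ubound; exists f.
rewrite -poweR_EFin; apply: gt0_ler_poweR; rewrite ?invr_ge0 //.
  by rewrite in_itv /= lee_fin c0 leey.
by rewrite in_itv /= leey (le_trans _ cE).
Qed.

Unset Implicit Arguments.
Set Strict Implicit.

Theorem theorem2p1 (R : realType) (n : nat) (hn : (1 <= n)%N)
    (p : R) (hp : 1 <= p)
    (d : measure_display) (Omega : measurableType d) (P : probability Omega R)
    (X : {RV P >-> n.-tuple R}) (hX : forall w : Omega, cube01 (X w))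
    (phi : n.-tuple (R * R) -> R)
    (hphi : measurable_fun (@pair_cube01 R n) phi) :
  (((1 / 2) `^ (2 + 1 / p) * (1 / n%:R))%:E
     <= worst_case_error P p (estimator X phi))%E.
Proof.
pose m := (2 * n)%N.
have n0 : 0 < n%:R :> R by rewrite ltr0n.
have m0 : (0 < m)%N by rewrite muln_gt0.
have mE : m%:R = 2 * n%:R :> R by rewrite natrM.
have mR0 : 0 < m%:R :> R by rewrite ltr0n.
pose t (k : nat) : R := k%:R / m%:R.
pose I (i : 'I_m) : set R := `[t i, t i.+1[%classic.
have tlt k : t k < t k.+1 by rewrite ltr_pM2r ?invr_gt0 // ltr_nat.
have tle k l : (k <= l)%N -> t k <= t l.
  by move=> kl; rewrite ler_pM2r ?invr_gt0 // ler_nat.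
have t01 k : (k <= m)%N -> t k \in `[0, 1].
  move=> km; rewrite in_itv /= divr_ge0 //= ler_pdivrMr // mul1r ler_nat //.
have tI : trivIset setT I.
  apply/trivIsetP => i j _ _ ij.
  wlog lt : i j ij / (i < j)%N => [hw|].
    move: (ij); rewrite -val_eqE neq_ltn => /orP[/hw|]; first exact.
    by move=> /hw h; rewrite setIC h // eq_sym.
  apply/seteqP; split=> // x []; rewrite /I /= !in_itv /=.
  move=> /andP[_ xi] /andP[jx _].
  by have := lt_le_trans xi (le_trans (tle _ _ lt) jx); rewrite ltxx.
have mX : measurable_fun setT X by exact: measurable_funPT.
have mI i : measurable (I i) by exact: measurable_itv.
have [i [mH PH]] := rarely_hit_cell P m0 mX mI tI.
set H := [set _ | _] in mH PH.
(* h is half the length 1 / (2n) of a cell. *)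
pose a := t i; pose b := t i.+1; pose h : R := (4 * n%:R)^-1.
have ba : b - a = 2 * h.
  rewrite /b /a /t /h mE -mulrBl -natr1 addrAC subrr add0r mul1r.
  by field; lra.
have h0 : 0 <= h by rewrite invr_ge0 mulr_ge0 // ltW.
have PHc : (2^-1%:E <= P (~` H))%E.
  rewrite probability_setC //.
  have -> : (2^-1 : R) = 1 - n%:R / m%:R by rewrite mE; field; lra.
  by rewrite EFinB leeB.
have mest c : measurable_fun setT (estimator X phi (step c)).
  apply: measurable_estimator => //; first exact: measurable_step.
  by have [] := step_monotone c.
have hab : 2 * h <= `|integral01 (step a) - integral01 (step b)|.
  rewrite !integral01_step ?t01 //; last by rewrite ltnW.
  have -> : 1 - a - (1 - b) = b - a by ring.
  by rewrite ba ler_norm.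
have agree : {in ~` H, estimator X phi (step a)
                    =1 estimator X phi (step b)}.
  move=> w; rewrite inE => nH; rewrite /estimator; congr phi.
  apply: samples_step_eq; first exact/ltW/tlt.
  by move=> j; apply/negP => Ij; apply: nH; exists j.
have key := two_point_expectation P hp h0 hab
  (mest a) (mest b) (measurableC mH) agree.
pose c := h `^ p / 2.
have c0 : 0 <= c by rewrite divr_ge0 // powR_ge0.
have -> : (1 / 2) `^ (2 + 1 / p) * (1 / n%:R) = c `^ p^-1.
  have p0 : p != 0 by lra.
  rewrite /c powRM ?powR_ge0 ?invr_ge0 // -powRrM mulfV // powRr1 //.
  rewrite !mul1r powRD; last by rewrite invr_eq0 pnatr_eq0 implybT.
  rewrite powR_mulrn ?invr_ge0 // mulrAC; congr *%R.
  by rewrite /h; field; lra.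
have p0 : 0 <= p by lra.
have [ca|ca] := leP c%:E 'E_P[fun w => (`|integral01 (step a)
                              - estimator X phi (step a) w| `^ p)%R]%E.
  exact: (le_worst_case_error p0 c0 (step_monotone a)).
have [cb|cb] := leP c%:E 'E_P[fun w => (`|integral01 (step b)
                              - estimator X phi (step b) w| `^ p)%R]%E.
  exact: (le_worst_case_error p0 c0 (step_monotone b)).
have := le_lt_trans key (lteD ca cb).
suff : (c%:E + c%:E <= (2 * h `^ p)%:E * P (~` H))%E.
  by move=> /le_lt_trans le /le; rewrite ltxx.
apply: (@le_trans _ _ ((2 * h `^ p)%:E * 2^-1%:E)%E); last first.
  by apply: lee_wpmul2l => //; rewrite lee_fin mulr_ge0 // powR_ge0.
by rewrite -EFinD -EFinM lee_fin /c; lra.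
Qed.
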